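(* Let $U$ be a strictly convex open set in a finite-dimensional topological vector space $X$ and let $Y$ be a Banach space. Then every $F_\sigma$-measurable function $f:\partial U\to Y$ can be extended to a linearly continuous function $\bar f:X\to Y$.
   Context: All topological vector spaces are over $\mathbb R$ and are assumed to be Hausdorff. $\partial U$ denotes the topological boundary of $U$ in $X$, with the subspace topology. A subset $C$ of a topological vector space $X$ is strictly convex if for any distinct points $x,y\in\overline{C}$ the open segment $(x;y)=\{(1-t)x+ty:0<t<1\}$ is contained in $C$. A subset $U$ of a topological space $Y$ is functionally open if $U=g^{-1}(V)$ for some continuous $g:Y\to\mathbb R$ and some open $V\subseteq\mathbb R$. A function $f:X\to Y$ between topological spaces is $F_\sigma$-measurable if for every functionally open $U\subset Y$ the preimage $f^{-1}(U)$ is of type $F_\sigma$ in $X$ (a countable union of closed sets). A function $f:X\to Y$ from a topological vector space $X$ to a topological space $Y$ is linearly continuous if for any $x,v\in X$ the function $\mathbb R\to Y$, $t\mapsto f(x+tv)$, is continuous. *)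

(* Defs.v *)
From HB Require Import structures.
From mathcomp Require Import all_boot all_order all_algebra.
From mathcomp Require Import all_classical all_reals all_analysis.
From mathcomp Require Import borel_hierarchy.

Set Implicit Arguments.
Unset Strict Implicit.
Unset Printing Implicit Defensive.

Import Order.TTheory GRing.Theory Num.Theory.
Import numFieldNormedType.Exports.

Local Open Scope classical_set_scope.
Local Open Scope ring_scope.

Definition boundary (X : topologicalType) (A : set X) : set X :=
  closure A `\` interior A.

(* [Vector.axiom n X] is the type of linear bijections from X to 'rV[R]_n. *)
Definition finite_dimensional (R : realType) (X : lmodType R) : Prop :=
  exists n : nat, inhabited (Vector.axiom n X).

Definition open_segment (R : realType) (X : lmodType R) (x y : X) : set X :=
  [set (1 - t) *: x + t *: y | t in [set t : R | 0 < t < 1]].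

Definition strictly_convex (R : realType) (X : topologicalLmodType R)
    (C : set X) : Prop :=
  forall x y : X, closure C x -> closure C y -> x <> y ->
    open_segment x y `<=` C.

Definition functionally_open (R : realType) (Y : topologicalType)
    (A : set Y) : Prop :=
  exists g : Y -> R, exists V : set R,
    [/\ continuous g, open V & A = g @^-1` V].

Definition Fsigma_measurable (R : realType) (S Y : topologicalType)
    (f : S -> Y) : Prop :=
  forall A : set Y, functionally_open R A -> Fsigma (f @^-1` A).

Definition linearly_continuous (R : realType) (X : topologicalLmodType R)
    (Y : topologicalType) (f : X -> Y) : Prop :=
  forall x v : X, continuous (fun t : R => f (x + t *: v)).

(* Main.v *)
Require Import Defs.
From HB Require Import structures.
From mathcomp Require Import all_boot all_order all_algebra.
From mathcomp Require Import all_classical all_reals all_analysis.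
From mathcomp Require Import borel_hierarchy.
From mathcomp Require Import ring lra.
Import Order.TTheory GRing.Theory Num.Theory.
Import numFieldNormedType.Exports.
Local Open Scope classical_set_scope.
Local Open Scope ring_scope.
Set Implicit Arguments.
Unset Strict Implicit.
Unset Printing Implicit Defensive.

(** A line meets the boundary S of a strictly convex open set U in at most two
    points, so linear continuity constrains an extension only at isolated
    parameters of each line.  The extension is built to be continuous off S and
    to converge to f along every line through a point of S.  Coordinates reduce
    everything to the space of row vectors: a Hausdorff topology compatible with
    a finite-dimensional vector space is the usual one
    ([coord_continuous_of_hausdorff]).

    First, f is a pointwise limit on S of functions f_k continuous on the whole
    space.  A Baire category argument shows that every nonempty closed part of S
    has a nonempty relatively open piece on which f oscillates little
    ([small_oscillation]); since the space has a countable base, for each e > 0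
    countably many closed sets on which f is e-close to a constant cover S
    ([small_oscillation_cover]).  Piecewise constant functions on such covers are
    limits of continuous functions, and so is their uniform limit f
    ([baire_one_of_covers]).

    Next, let d be the distance to S, truncated at 1, and choose thresholds
    delta_0 > delta_1 > ... tending to 0.  The function F that equals f_k at
    d = delta_k, and interpolates linearly in d between consecutive thresholds,
    is continuous off S and equals f on S.

    Finally, let s be a point of S.  When s + t v lies in the shell
    delta_(k+1) <= d <= delta_k, the value F(s + t v) is a convex combination of
    f_k(s + t v) and f_(k+1)(s + t v), so it suffices that these be close to
    f_k(s) and f_(k+1)(s).  If the ray from s along v enters U, convexity makes d
    grow at least linearly along it ([cone_bound]), so t is small compared with
    what the uniform continuity of f_k requires once delta_k is small compared
    with the modulus of f_k.  If the ray avoids U it may be tangent to S, and d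
    may then grow arbitrarily slowly; but by strict convexity such a ray never
    returns to S, and compactness turns this into a bound for d that is uniform
    in the ray and in s, for s of norm at most k ([uniform_modulus]).  Since each
    point of S satisfies this restriction for all large k, one sequence delta
    serves all points and all directions ([extend_from_boundary]). *)

(** * Preimages under continuous maps *)

Lemma closed_preimage (T T' : topologicalType) (g : T -> T') (A : set T') :
  continuous g -> closed A -> closed (g @^-1` A).
Proof. by move=> cg; apply: (continuous_closedP g).1. Qed.

Lemma closure_preimage_sub (T T' : topologicalType) (g : T -> T') (A : set T') :
  continuous g -> closure (g @^-1` A) `<=` g @^-1` closure A.
Proof. by move=> cg t At B /cg /At[u [Au Bu]]; exists (g u). Qed.

(** * The distance to a set, truncated at 1 *)

Section truncated_distance.
Variables (R : realType) (V : normedModType R).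
Implicit Types (A : set V) (x y : V).

(** Adjoining 1 bounds the distance and gives it a value when A is empty. *)
Definition tdist A x : R := inf ([set 1] `|` [set `|x - a| | a in A]).

Lemma tdist_has_inf A x : has_inf ([set 1] `|` [set `|x - a| | a in A]).
Proof.
split; first by exists 1; left.
by exists 0 => _ [->//|[a _ <-]].
Qed.

Lemma tdist_le1 A x : tdist A x <= 1.
Proof. by apply: ge_inf; [case: (tdist_has_inf A x)|left]. Qed.

Lemma tdist_le A x a : A a -> tdist A x <= `|x - a|.
Proof.
by move=> Aa; apply: ge_inf; [case: (tdist_has_inf A x)|right; exists a].
Qed.

Lemma le_tdist A x m : m <= 1 -> (forall a, A a -> m <= `|x - a|) ->
  m <= tdist A x.
Proof.
move=> m1 mA; apply: lb_le_inf; first by case: (tdist_has_inf A x).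
by move=> _ [->//|[a Aa <-]]; exact: mA.
Qed.

Lemma tdist_ge0 A x : 0 <= tdist A x.
Proof. by apply: le_tdist. Qed.

Lemma tdist_eq0 A x : A x -> tdist A x = 0.
Proof.
move=> Ax; apply/eqP; rewrite eq_le tdist_ge0 andbT.
by rewrite (le_trans (tdist_le x Ax))// subrr normr0.
Qed.

Lemma tdist_lt A x e : e <= 1 -> tdist A x < e -> exists2 a, A a & `|x - a| < e.
Proof.
move=> e1 xe; apply: contrapT => nA.
suff : e <= tdist A x by rewrite leNgt xe.
apply: le_tdist => // a Aa; rewrite leNgt; apply/negP => ae.
by apply: nA; exists a.
Qed.

Lemma tdist_lipschitz A x y : tdist A x <= tdist A y + `|x - y|.
Proof.
rewrite -lerBlDr; apply: le_tdist => [|a Aa].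
  by rewrite (le_trans _ (tdist_le1 A x))// gerBl.
rewrite lerBlDr (le_trans (tdist_le x Aa))//.
by rewrite -(subrKA y) addrC ler_normD.
Qed.

Lemma tdist_continuous A : continuous (tdist A).
Proof.
move=> x; apply/cvgrPdist_le => e e0.
near=> y; rewrite ler_distl lerBlDr.
have xy : `|x - y| <= e by near: y; apply: cvgr_dist_le.
rewrite (le_trans (tdist_lipschitz A y x)) 1?(le_trans (tdist_lipschitz A x y))//.
  by rewrite lerD2l.
by rewrite lerD2l distrC.
Unshelve. all: end_near. Qed.

Lemma tdist_gt0 A x : closed A -> ~ A x -> 0 < tdist A x.
Proof.
move=> cA nAx; rewrite lt_neqAle tdist_ge0 andbT eq_sym; apply/eqP => d0.
apply: nAx; apply: cA => B /nbhs_ballP[e /= e0 eB].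
have [||a Aa xa] := @tdist_lt A x (Num.min e 1).
- by rewrite ge_min lexx orbT.
- by rewrite d0 lt_min e0 ltr01.
exists a; split=> //; apply: eB; rewrite -ball_normE /=.
by rewrite (lt_le_trans xa)// ge_min lexx.
Qed.

End truncated_distance.

(** * Baire category on closed sets *)

Section baire.
Variable R : realType.

Lemma cball_nbhs (V : normedModType R) (x : V) (O : set V) : nbhs x O ->
  exists2 e, 0 < e & [set z | `|x - z| <= e] `<=` O.
Proof.
move=> /nbhs_ballP[e /= e0 eO]; exists (e / 2); first exact: divr_gt0.
move=> z /= xz; apply: eO; rewrite -ball_normE /=.
by rewrite (le_lt_trans xz)// ltr_pdivrMr// ltr_pMr// ltr1n.
Qed.

Lemma closed_cball (V : normedModType R) (x : V) (r : R) :
  closed [set z | `|x - z| <= r].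
Proof. exact: closed_closed_ball_. Qed.

Lemma compact_cball n (x : 'rV[R]_n) (r : R) :
  compact [set z | `|x - z| <= r].
Proof.
apply: bounded_closed_compact; last exact: closed_cball.
exists (`|x| + r); split; first exact: num_real.
move=> M rM z /= xz; rewrite (le_trans _ (ltW rM))//.
by rewrite -[z](subKr x) (le_trans (ler_normB _ _))// lerD2l.
Qed.

(** Otherwise every ball centred on F contains a smaller closed ball centred on F
    that avoids any prescribed G i.  Avoiding the G i one after the other yields
    nested nonempty compact pieces of F, whose common point lies in no G i. *)
Lemma closed_baire n (F : set 'rV[R]_n) (G : nat -> set 'rV[R]_n) x0 e0 :
  closed F -> (forall i, closed (G i)) -> F x0 -> 0 < e0 ->
  F `&` ball x0 e0 `<=` \bigcup_i G i ->
  exists i x e, [/\ F x, 0 < e, ball x e `<=` ball x0 e0 &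
    F `&` ball x e `<=` G i].
Proof.
move=> cF cG Fx0 e0_gt0 FG; apply: contrapT => nex.
pose good (p : 'rV[R]_n * R) :=
  [/\ F p.1, 0 < p.2 & [set z | `|p.1 - z| <= p.2] `<=` ball x0 e0].
pose K (p : 'rV[R]_n * R) := F `&` [set z | `|p.1 - z| <= p.2].
have step k p : exists q, good p -> [/\ good q, K q `<=` K p & K q `<=` ~` G k].
  have [[Fp p0 pb]|] := pselect (good p); last by move=> np; exists p.
  have [y Fy [py nGy]] : exists2 y, F y & ball p.1 p.2 y /\ ~ G k y.
    apply: contrapT => ny; apply: nex; exists k, p.1, p.2; split => //.
      by move=> z; rewrite -{1}ball_normE => /ltW; exact: pb.
    by move=> z [Fz pz]; apply: contrapT => nGz; apply: ny; exists z.
  have [|e e_gt0 eO] := @cball_nbhs _ y (ball p.1 p.2 `&` ~` G k).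
    apply: filterI; last by apply: open_nbhs_nbhs; split=> //; exact/closed_openC.
    by apply: open_nbhs_nbhs; split => //; exact: ball_open.
  have ep : [set z | `|y - z| <= e] `<=` [set z | `|p.1 - z| <= p.2].
    by move=> z /eO[+ _]; rewrite -ball_normE => /ltW.
  exists (y, e) => _; split => /=.
  - by split => //= z /ep; exact: pb.
  - by move=> z [Fz /ep pz].
  - by move=> z [_ /eO[]].
have [e e_gt0 eb] := @cball_nbhs _ x0 (ball x0 e0) (nbhsx_ballx _ _ e0_gt0).
have [next nextP] := choice (fun kp : nat * ('rV[R]_n * R) => step kp.1 kp.2).
pose p := fix p k := if k is k'.+1 then next (k', p k') else (x0, e).
have goodp k : good (p k).
  by elim: k => [|k IH] //=; case: (nextP (k, p k) IH).
have Kle k m : (k <= m)%N -> K (p m) `<=` K (p k).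
  move=> /subnK <-; elim: (m - k)%N => [//|j IH]; rewrite addSn.
  have [_ Knext _] := nextP ((j + k)%N, p (j + k)%N) (goodp _).
  exact: subset_trans Knext IH.
have Kp k : K (p k) (p k).1.
  by have [? p0 _] := goodp k; split => //=; rewrite subrr normr0 ltW.
have K0 : compact (K (p 0%N)).
  apply: subclosed_compact (@compact_cball n x0 e) _ => [|z []//].
  by apply: closedI => //; exact: closed_cball.
have [|l [Kl cl]] := K0 ((p k).1 @[k --> \oo]) _.
  by exists 0%N => // k _ /=; exact: Kle (leq0n k) _ (Kp k).
have Kpl k : K (p k) l.
  have cK : closed (K (p k)) by apply: closedI => //; exact: closed_cball.
  apply: cK => B /cl; apply; exists k => // m /= km.
  exact: Kle km _ (Kp m).
have [|k _ Gl] := FG l.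
  by case: Kl => Fl xl; split=> //; exact: eb.
by have [_ _ /(_ _ (Kpl k.+1))] := nextP (k, p k) (goodp k).
Qed.

Lemma closed_baire_countable n (I : countType) (F : set 'rV[R]_n)
    (G : I -> set 'rV[R]_n) x0 e0 :
  closed F -> (forall i, closed (G i)) -> F x0 -> 0 < e0 ->
  F `&` ball x0 e0 `<=` \bigcup_i G i ->
  exists i x e, [/\ F x, 0 < e, ball x e `<=` ball x0 e0 &
    F `&` ball x e `<=` G i].
Proof.
move=> cF cG Fx0 e0_gt0 FG.
have [||k [x [e [Fx e_gt0 xe FGk]]]] :=
    @closed_baire _ F (fun k => oapp G set0 (unpickle k)) x0 e0 cF _ Fx0 e0_gt0.
- by move=> k; case: unpickle => [i|] /=; [exact: cG|exact: closed0].
- by move=> z /FG[i _ Giz]; exists (pickle i) => //; rewrite pickleK.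
have := FGk x (conj Fx (ballxx x e_gt0)).
by move: FGk; case: unpickle => [i|] //= FGi _; exists i, x, e.
Qed.

End baire.

(** * Closed covers of small oscillation *)

Section cover.
Variable R : realType.

Lemma rV_countable_base n : exists B : nat -> set 'rV[R]_n,
  (forall k, open (B k)) /\
  forall x e, 0 < e -> exists2 k, B k x & B k `<=` ball x e.
Proof.
pose b (p : 'rV[rat]_n * nat) : set 'rV[R]_n :=
  ball (map_mx (@ratr R) p.1) (p.2.+1%:R^-1).
exists (fun k => oapp b set0 (unpickle k)); split=> [k|x e e_gt0].
  by case: unpickle => [p|] /=; [exact: ball_open|exact: open0].
have [m me] : exists m, (m.+1%:R^-1 : R) < e / 2.
  have [//|m] := @ltr_add_invr R 0 (e / 2) _; first exact: divr_gt0.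
  by rewrite add0r; exists m.
have m_gt0 : 0 < (m.+1%:R^-1 : R) by rewrite invr_gt0.
have qP i : exists q : rat, `|x ord0 i - ratr q| < m.+1%:R^-1.
  have [|q] := @rat_in_itvoo R (x ord0 i - m.+1%:R^-1) (x ord0 i + m.+1%:R^-1).
    by rewrite ltrD2l gtrN.
  by rewrite in_itv /= => xq; exists q; rewrite distrC ltr_distl.
have [q qx] := choice qP.
pose p : 'rV[rat]_n * nat := (\row_i q i, m).
have px : ball (map_mx (@ratr R) p.1) (m.+1%:R^-1) x.
  apply: ball_sym; split => // i j; rewrite (ord1 i) !mxE; exact: qx.
exists (pickle p); rewrite pickleK //= => z pz.
rewrite (splitr e); apply: (@ball_triangle _ _ (map_mx (@ratr R) p.1)).
  exact: le_ball (ltW me) _ (ball_sym px).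
exact: le_ball (ltW me) _ pz.
Qed.

(** Greedy choice: no finite set of earlier values may exhaust a later constraint
    up to distance e. *)
Lemma separated_sequence (T : eqType) (Y : normedModType R) (f : T -> Y)
    (P : nat -> set T) (e : R) :
  (forall k (s : seq T), exists2 z, P k z &
     forall a, a \in s -> e <= `|f z - f a|) ->
  exists z : nat -> T, (forall k, P k (z k)) /\
    forall k m, (m < k)%N -> e <= `|f (z k) - f (z m)|.
Proof.
move=> H.
have /choice[g gP] : forall p : nat * seq T, exists z, P p.1 z /\
    forall a, a \in p.2 -> e <= `|f z - f a|.
  by move=> [k s]; have [z ? ?] := H k s; exists z.
pose h := fix h k := if k is k'.+1 then g (k', h k') :: h k' else [::].
exists (fun k => g (k, h k)); split=> [k|k m mk].
  by have [] := gP (k, h k).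
apply: (gP (k, h k)).2 => /=.
elim: k mk => // k IH; rewrite ltnS leq_eqVlt => /orP[/eqP->|/IH mk] /=.
  exact: mem_head.
by rewrite inE mk orbT.
Qed.

Variables (n : nat) (Y : normedModType R).
Variables (S : set 'rV[R]_n) (f : 'rV[R]_n -> Y).
Hypothesis mf : forall A, functionally_open R A -> Fsigma (S `&` f @^-1` A).

Lemma functionally_open_ball (y : Y) (e : R) :
  functionally_open R [set z | `|y - z| < e].
Proof.
exists (fun z => `|y - z|), [set t | t < e]; split => //.
by move=> z; apply: cvg_norm; apply: cvgB; [exact: cvg_cst|exact: cvg_id].
Qed.

Lemma functionally_open_tdist (E : set Y) :
  functionally_open R [set z | 0 < tdist E z].
Proof.
exists (tdist E), [set t | 0 < t]; split => //.
exact: tdist_continuous.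
Qed.

(** Either some basic open set meets F in a part whose image is covered by
    finitely many e-balls, and Baire's theorem singles out one of these balls; or
    one picks e-separated values f (z k) such that the points z k of even index,
    and those of odd index, are both dense in F.  In the second case let E b be
    the set of the values with index of parity b.  By
    separation each point of Y is at positive distance from E true or from
    E false; both conditions define functionally open sets, so their preimages
    are F_sigma sets covering F, and by Baire one of them contains a relatively
    open part of F.  This contradicts the density of one of the two families. *)
Lemma small_oscillation (F : set 'rV[R]_n) x0 (e : R) :
  closed F -> F `<=` S -> F x0 -> 0 < e ->
  exists x r y, [/\ F x, 0 < r &
    forall z, F z -> ball x r z -> `|f z - y| <= e].
Proof.
move=> cF FS Fx0 e_gt0.
have [B [oB Bbase]] := rV_countable_base n.
have [[k [x1 [Fx1 Bx1] [s sP]]]|nB] := pselect (exists k, exists2 x1,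
    (F `&` B k) x1 & exists s : seq 'rV[R]_n, forall z, F z -> B k z ->
      exists2 a, a \in s & `|f a - f z| < e).
  have /choice[G GP] : forall a, exists G : nat -> set 'rV[R]_n,
      (forall i, closed (G i)) /\
      S `&` f @^-1` [set z | `|f a - z| < e] = \bigcup_i G i.
    by move=> a; have [G cG eG] := mf (functionally_open_ball (f a) e); exists G.
  have /nbhs_ballP[r1 /= r1_gt0 r1B] := open_nbhs_nbhs (conj (oB k) Bx1).
  have [||[i j] [x [r [Fx r_gt0 _ FG]]]] := @closed_baire_countable R n _ F
      (fun ij : nat * nat => G (nth x1 s ij.1) ij.2) x1 r1 cF _ Fx1 r1_gt0.
  - by move=> [i j]; apply: (GP _).1.
  - move=> z [Fz /r1B Bz]; have [a sa az] := sP z Fz Bz.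
    have : (S `&` f @^-1` [set z | `|f a - z| < e]) z by split => //; exact: FS.
    rewrite (GP a).2 => -[j _ Gz]; exists (index a s, j) => //=.
    by rewrite nth_index.
  exists x, r, (f (nth x1 s i)); split => // z Fz xz.
  have : (S `&` f @^-1` [set z | `|f (nth x1 s i) - z| < e]) z.
    by rewrite (GP _).2; exists j => //; exact: FG.
  by rewrite distrC => -[_ /ltW].
(* When B k misses F the constraint is void, but a point is still needed: it is
   taken in some B k' that meets F. *)
have pick k (s : seq 'rV[R]_n) : exists2 z, F z /\
    (F `&` B k !=set0 -> B k z) & forall a, a \in s -> e <= `|f z - f a|.
  suff [k' k'F k'B] : exists2 k', F `&` B k' !=set0 &
      F `&` B k !=set0 -> B k' `<=` B k.
    apply: contrapT => nz; apply: nB; exists k'.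
    have [x1 Fx1] := k'F; exists x1 => //; exists s => z Fz Bz.
    apply: contrapT => na; apply: nz; exists z => [|a sa].
      by split => // /k'B; exact.
    by rewrite leNgt; apply/negP => ea; apply: na; exists a; rewrite 1?distrC.
  have [kF|nkF] := pselect (F `&` B k !=set0); first by exists k => // _ ?.
  by have [k' Bk' _] := Bbase x0 1 ltr01; exists k' => //; exists x0.
have [z [zP zsep]] :=
  @separated_sequence _ _ f (fun k => [set z | F z /\
    (F `&` B k./2 !=set0 -> B k./2 z)]) e (fun k => pick k./2).
have {}zsep k m : k != m -> e <= `|f (z k) - f (z m)|.
  by rewrite neq_ltn => /orP[|] /zsep //; rewrite distrC.
pose E b := range (fun k => f (z (nat_of_bool b + k.*2)%N)).
have EW y : exists b, 0 < tdist (E b) y.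
  apply: contrapT => nb.
  have near_E b : exists2 a, E b a & `|y - a| < Num.min (e / 2) 1.
    apply: tdist_lt; first by rewrite ge_min (lexx 1) orbT.
    have : tdist (E b) y <= 0 by rewrite leNgt; apply/negP => h; apply: nb; exists b.
    by move=> /le_lt_trans; apply; rewrite lt_min ltr01 andbT divr_gt0.
  have [_ [k _ <-] ky] := near_E true; have [_ [m _ <-] my] := near_E false.
  have : e <= `|f (z (true + k.*2)%N) - f (z (false + m.*2)%N)|.
    by apply: zsep; apply/eqP => /(congr1 odd); rewrite !oddD !odd_double.
  apply/negP; rewrite -ltNge (splitr e) -(subrKA y).
  rewrite (le_lt_trans (ler_normD _ _))// ltrD//.
    by rewrite distrC (lt_le_trans ky)// ge_min lexx.
  by rewrite (lt_le_trans my)// ge_min lexx.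
have /choice[G GP] : forall b, exists G : nat -> set 'rV[R]_n,
    (forall i, closed (G i)) /\
    S `&` f @^-1` [set y | 0 < tdist (E b) y] = \bigcup_i G i.
  by move=> b; have [G cG eG] := mf (functionally_open_tdist (E b)); exists G.
have [||[b j] [x [r [Fx r_gt0 _ FG]]]] := @closed_baire_countable R n _ F
    (fun bj : bool * nat => G bj.1 bj.2) x0 1 cF _ Fx0 ltr01.
- by move=> [b j]; apply: (GP _).1.
- move=> y [Fy _]; have [b yb] := EW (f y).
  have : (S `&` f @^-1` [set y | 0 < tdist (E b) y]) y by split=> //; exact: FS.
  by rewrite (GP b).2 => -[j _ Gy]; exists (b, j).
have [k Bx kB] := Bbase x r r_gt0.
have [Fz Bz] := zP (b + k.*2)%N; move: Bz; rewrite half_bit_double => Bz.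
have : (S `&` f @^-1` [set y | 0 < tdist (E b) y]) (z (b + k.*2)%N).
  rewrite (GP _).2; exists j => //; apply: FG; split => //; apply: kB.
  by apply: Bz; exists x.
by move=> [_ /=]; rewrite tdist_eq0 ?ltxx//; exists k.
Qed.

(** Cantor-Bendixson argument.  Let O be the union of the basic open sets whose
    trace on S can be covered; there are countably many of them, so the trace of O
    can be covered.  If S were not inside O, a piece of S minus O of small
    oscillation would enlarge O. *)
Lemma small_oscillation_cover (e : R) : closed S -> 0 < e ->
  exists (C : nat -> set 'rV[R]_n) (y : nat -> Y),
    [/\ forall i, closed (C i), S `<=` \bigcup_i C i &
        forall i z, S z -> C i z -> `|f z - y i| <= e].
Proof.
move=> cS e_gt0.
pose covered A := exists (C : nat -> set 'rV[R]_n) (y : nat -> Y),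
    [/\ forall i, closed (C i), A `<=` \bigcup_i C i &
        forall i z, S z -> C i z -> `|f z - y i| <= e].
have [B [oB Bbase]] := rV_countable_base n.
pose good k := covered (S `&` B k).
pose O := \bigcup_(k in good) B k.
have coveredO : covered (S `&` O).
  have /choice[D DP] : forall k, exists D : (nat -> set 'rV[R]_n) * (nat -> Y),
      [/\ forall i, closed (D.1 i), good k -> S `&` B k `<=` \bigcup_i D.1 i &
      forall i z, S z -> D.1 i z -> `|f z - D.2 i| <= e].
    move=> k; have [[C [y [cC CB Cy]]]|nk] := pselect (good k).
      by exists (C, y).
    by exists (fun=> set0, fun=> 0); split => //= _; exact: closed0.
  exists (fun m => if unpickle m is Some (k, i) then (D k).1 i else set0).
  exists (fun m => if unpickle m is Some (k, i) then (D k).2 i else 0).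
  split=> [m|z [Sz [k gk Bz]]|m z Sz].
  - case: unpickle => [[k i]|]; last exact: closed0.
    by have [+ _ _] := DP k; exact.
  - have [_ /(_ gk z (conj Sz Bz))[i _ Dz] _] := DP k.
    by exists (pickle (k, i)) => //; rewrite pickleK.
  - case: unpickle => [[k i]|] // Dz.
    by have [_ _] := DP k; exact.
suff SO : S `<=` O.
  have [C [y [cC CO Cy]]] := coveredO; exists C, y; split => // z Sz.
  by apply: CO; split => //; exact: SO.
move=> x0 Sx0; apply: contrapT => nOx0.
have cF : closed (S `&` ~` O).
  by apply: closedI => //; apply: open_closedC; apply: bigcup_open.
have [||x [r [y [[Sx nOx] r_gt0 fy]]]] :=
  @small_oscillation (S `&` ~` O) x0 e cF _ _ e_gt0; [by move=> z []|by []|].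
apply: nOx.
have [r' r'_gt0 r'r] := cball_nbhs (nbhsx_ballx x r r_gt0).
have [k Bx kB] := Bbase x r' r'_gt0.
exists k => //.
have [C [y' [cC CO Cy]]] := coveredO.
exists (fun i => if i is j.+1 then C j
                 else (S `&` ~` O) `&` [set z | `|x - z| <= r']).
exists (fun i => if i is j.+1 then y' j else y).
split=> [[|i]//|z [Sz Bz]|[|i] z Sz].
- by apply: closedI => //; exact: closed_cball.
- have [Oz|nOz] := pselect (O z).
    by have [i _ Cz] := CO z (conj Sz Oz); exists i.+1.
  exists 0%N => //; split => //=.
  by have := kB _ Bz; rewrite -ball_normE => /ltW.
- by move=> [Fz /r'r xz]; exact: fy.
- exact: Cy.
Qed.

End cover.

(** * Functions of the first Baire class *)

Section baire_one.
Variables (R : realType) (V Y : normedModType R).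

(** Retraction of Y onto the closed ball of radius r. *)
Definition radial_trunc (r : R) (y : Y) : Y := (r / Num.max r `|y|) *: y.

Lemma norm_radial_trunc r y : 0 < r -> `|radial_trunc r y| <= r.
Proof.
move=> r0; have m0 : 0 < Num.max r `|y| by rewrite lt_max r0.
rewrite normrZ ger0_norm; last by rewrite divr_ge0// ltW.
by rewrite mulrAC ler_pdivrMr// ler_pM2l// le_max lexx orbT.
Qed.

Lemma radial_trunc_id r y : 0 < r -> `|y| <= r -> radial_trunc r y = y.
Proof.
by move=> r0 yr; rewrite /radial_trunc max_l// divff ?gt_eqF// scale1r.
Qed.

Lemma radial_trunc_continuous r : 0 < r -> continuous (radial_trunc r).
Proof.
move=> r0 y; apply: cvgZ; last exact: cvg_id.
apply: cvgM; first exact: cvg_cst.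
apply: cvgV; first by rewrite gt_eqF// lt_max r0.
by apply: continuous_max; [exact: cvg_cst|exact: norm_continuous].
Qed.

Lemma geometric_lt (e : R) : 0 < e -> exists k, (2^-1 ^+ k : R) < e.
Proof.
move=> e0; have /cvgrPdist_lt/(_ _ e0)[k _ /(_ k (leqnn _))] :
    (2^-1 ^+ k : R) @[k --> \oo] --> 0.
  by apply: cvg_expr; rewrite ger0_norm ?invr_ge0// invf_lt1// ltr1n.
rewrite /= sub0r normrN ger0_norm ?exprn_ge0 ?invr_ge0// => ke.
by exists k.
Qed.

Lemma sum_geometric_tail (k n : nat) :
  (k <= n)%N -> \sum_(k <= j < n) 2 * (2^-1 ^+ j : R) <= 4 * 2^-1 ^+ k.
Proof.
move=> kn; suff -> : \sum_(k <= j < n) 2 * (2^-1 ^+ j : R) =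
    4 * 2^-1 ^+ k - 4 * 2^-1 ^+ n.
  by rewrite gerBl mulr_ge0// exprn_ge0// invr_ge0.
elim: n kn => [|n IH]; first by rewrite leqn0 => /eqP ->; rewrite big_geq ?subrr.
rewrite leq_eqVlt => /orP[/eqP ->|]; first by rewrite big_geq ?subrr.
rewrite ltnS => kn; rewrite big_nat_recr//= IH// exprS.
by field.
Qed.

(** Telescoping the approximations h k n of g k does not converge uniformly, but
    on S the increments g (k+1) - g k have norm at most 2 * 2^-k, so truncating
    the increments of the h k n at that radius changes no limit and makes the
    tails summable. *)
Lemma baire_one_uniform_limit (S : set V) (f : V -> Y) (g : nat -> V -> Y)
    (h : nat -> nat -> V -> Y) :
  (forall k n, continuous (h k n)) ->
  (forall k x, S x -> h k n x @[n --> \oo] --> g k x) ->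
  (forall k x, S x -> `|g k x - f x| <= 2^-1 ^+ k) ->
  exists F : nat -> V -> Y, (forall n, continuous (F n)) /\
    forall x, S x -> F n x @[n --> \oo] --> f x.
Proof.
move=> ch hg gf.
have r0 k : 0 < 2 * (2^-1 ^+ k : R) by rewrite mulr_gt0// exprn_gt0.
pose T k n x := radial_trunc (2 * 2^-1 ^+ k) (h k.+1 n x - h k n x).
pose F m n x := h 0%N n x + \sum_(0 <= k < m) T k n x.
have Tc k : continuous (radial_trunc (2 * 2^-1 ^+ k)).
  exact: radial_trunc_continuous.
have FS m n : F m.+1 n = F m n \+ T m n.
  by apply/funext => x; rewrite /F /= big_nat_recr//= addrA.
have F0 n : F 0%N n = h 0%N n.
  by apply/funext => x; rewrite /F big_geq// addr0.
(* 2^-k + 2^-(k+1) <= 2 * 2^-k *)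
have gT k x : S x -> radial_trunc (2 * 2^-1 ^+ k) (g k.+1 x - g k x) =
    g k.+1 x - g k x.
  move=> Sx; apply: radial_trunc_id => //.
  rewrite -(subrKA (f x)) (le_trans (ler_normD _ _))//.
  have : (2^-1 ^+ k.+1 : R) <= 2^-1 ^+ k.
    by rewrite exprS ger_pMl ?exprn_gt0// invf_le1// ler1n.
  have := gf k.+1 x Sx; have := gf k x Sx; rewrite (distrC (f x)); lra.
exists (fun n => F n n); split=> [n|x Sx].
  elim: {1}n => [|m IH]; first by rewrite F0.
  rewrite FS => x; apply: cvgD; first exact: IH.
  apply: (@continuous_cvg _ _ _ _ _ (fun z => h m.+1 n z - h m n z)).
    exact: Tc.
  by apply: cvgB; exact: ch.
have Fg k : F k n x @[n --> \oo] --> g k x.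
  elim: k => [|k IH].
    by under eq_fun do rewrite F0; exact: hg.
  under eq_fun do rewrite FS.
  rewrite -[g k.+1 x](subrKC (g k x)) -gT//; apply: cvgD => //.
  apply: (@continuous_cvg _ _ _ _ _ (fun n => h k.+1 n x - h k n x)).
    exact: Tc.
  by apply: cvgB; exact: hg.
apply/cvgrPdist_lt => e e0.
have [k ke] : exists k, 5 * (2^-1 ^+ k : R) < e / 2.
  have [|k ke] := @geometric_lt (e / 10); first by rewrite divr_gt0.
  by exists k; lra.
have /cvgrPdist_lt/(_ (e / 2)) := Fg k; rewrite divr_gt0// => /(_ isT) Fgk.
near=> n.
have kn : (k <= n)%N by near: n; exists k.
have FF : `|F k n x - F n n x| <= 4 * 2^-1 ^+ k.
  have -> : F k n x - F n n x = - \sum_(k <= j < n) T j n x.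
    by rewrite /F (@big_cat_nat _ _ _ k 0%N n)//= addrA opprD addNKr.
  rewrite normrN (le_trans (ler_norm_sum _ _ _))//.
  rewrite (le_trans _ (sum_geometric_tail kn))//.
  by apply: ler_sum => j _; exact: norm_radial_trunc.
have gF : `|g k x - F k n x| < e / 2 by near: n; exact: Fgk.
have := gf k x Sx; rewrite distrC => fg.
rewrite -(subrKA (g k x)) (le_lt_trans (ler_normD _ _))//.
have := ler_normD (g k x - F k n x) (F k n x - F n n x).
rewrite subrKA; lra.
Unshelve. all: end_near. Qed.

(** For large a this approximates the indicator function of C from above. *)
Definition tent (a : R) (C : set V) (x : V) : R :=
  Num.max 0 (1 - a * tdist C x).

(** When the tents are indicator functions of the sets C i, C (i+1), ...,
    C (i+m-1), this is the value y j for the first j with x in C j. *)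
Fixpoint blend (a : R) (C : nat -> set V) (y : nat -> Y) (m i : nat) (x : V) :=
  if m is m'.+1 then
    tent a (C i) x *: y i + (1 - tent a (C i) x) *: blend a C y m' i.+1 x
  else 0.

Lemma tent_continuous a C : continuous (tent a C).
Proof.
move=> x; apply: (@continuous_max _ _ (fun=> 0) (fun x => 1 - a * tdist C x)).
  exact: cvg_cst.
apply: cvgB; first exact: cvg_cst.
by apply: cvgM; [exact: cvg_cst|exact: tdist_continuous].
Qed.

Lemma blend_continuous a C y m i : continuous (blend a C y m i).
Proof.
elim: m i => [|m IH] i x /=; first exact: cvg_cst.
apply: cvgD; apply: cvgZ.
- exact: tent_continuous.
- exact: cvg_cst.
- by apply: cvgB; [exact: cvg_cst|exact: tent_continuous].
- exact: IH.
Qed.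

Lemma tent1 a C x : C x -> tent a C x = 1.
Proof. by move=> Cx; rewrite /tent tdist_eq0// mulr0 subr0 max_r. Qed.

Lemma tent_near0 C x : closed C -> ~ C x ->
  \forall n \near \oo, tent n%:R C x = 0.
Proof.
move=> cC nCx; have d0 := tdist_gt0 cC nCx; near=> n.
rewrite /tent max_l// subr_le0 -ler_pdivrMr// mul1r.
by near: n; exact: nbhs_infty_ger.
Unshelve. all: end_near. Qed.

Lemma blend_first a C y m i j x :
  (i <= j < i + m)%N -> C j x ->
  (forall l, (i <= l < j)%N -> tent a (C l) x = 0) -> blend a C y m i x = y j.
Proof.
elim: m i => [|m IH] i.
  by rewrite addn0 => /andP[/leq_ltn_trans h /h]; rewrite ltnn.
move=> /andP[]; rewrite leq_eqVlt => /orP[/eqP <- _ Cx _|ij jm Cx tl] /=.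
  by rewrite tent1// subrr scale0r addr0 scale1r.
rewrite tl ?leqnn// scale0r add0r subr0 scale1r; apply: IH => //.
  by rewrite ij addSnnS.
by move=> l /andP[il lj]; rewrite tl// lj ltnW.
Qed.

(** If i is the first index with x in C i, the finitely many tents of smaller
    index vanish at x once they are steep enough, because the sets are closed. *)
Lemma blend_near (C : nat -> set V) (y : nat -> Y) x :
  (forall i, closed (C i)) -> (\bigcup_i C i) x ->
  exists2 i, C i x & \forall n \near \oo, blend n%:R C y n 0 x = y i.
Proof.
move=> cC [i0 _ Ci0].
have [i Ci imin] : exists2 i, C i x & forall j, C j x -> (i <= j)%N.
  have ex : exists i, `[< C i x >] by exists i0; apply/asboolP.
  have [i /asboolP Ci imin] := ex_minnP ex.
  by exists i => // j Cj; apply: imin; apply/asboolP.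
exists i => //.
have : \forall n \near \oo, forall l : 'I_i, tent n%:R (C l) x = 0.
  apply: filter_forall => l; apply: tent_near0 => // /imin.
  by rewrite leqNgt ltn_ord.
move=> tl; near=> n; apply: blend_first => //.
  by rewrite add0n leq0n /=; near: n; exact: nbhs_infty_gt.
move=> l li; have tln : forall l : 'I_i, tent n%:R (C l) x = 0 by near: n.
exact: (tln (Ordinal li)).
Unshelve. all: end_near. Qed.

Lemma baire_one_of_covers (S : set V) (f : V -> Y) :
  (forall e : R, 0 < e -> exists (C : nat -> set V) (y : nat -> Y),
    [/\ forall i, closed (C i), S `<=` \bigcup_i C i &
        forall i z, S z -> C i z -> `|f z - y i| <= e]) ->
  exists F : nat -> V -> Y, (forall n, continuous (F n)) /\
    forall x, S x -> F n x @[n --> \oo] --> f x.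
Proof.
move=> H.
have /choice[D DP] : forall k : nat,
    exists D : (nat -> set V) * (nat -> Y), [/\ forall i, closed (D.1 i),
    S `<=` \bigcup_i D.1 i &
    forall i z, S z -> D.1 i z -> `|f z - D.2 i| <= 2^-1 ^+ k].
  move=> k; have [|C [y CP]] := H (2^-1 ^+ k); first by rewrite exprn_gt0.
  by exists (C, y).
have /choice[g gP] : forall kx : nat * V, exists z : Y, S kx.2 ->
    (exists2 i, (D kx.1).1 i kx.2 & z = (D kx.1).2 i) /\
    \forall n \near \oo, blend n%:R (D kx.1).1 (D kx.1).2 n 0 kx.2 = z.
  move=> [k x] /=; have [Sx|] := pselect (S x); last by exists 0.
  have [cD DS _] := DP k.
  have [i Di bi] := blend_near (D k).2 cD (DS _ Sx).
  by exists ((D k).2 i); split => //; exists i.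
apply: (@baire_one_uniform_limit S f (fun k x => g (k, x))
  (fun k n => blend n%:R (D k).1 (D k).2 n 0)).
- by move=> k n; exact: blend_continuous.
- by move=> k x Sx; apply: cvg_near_cst; exact: (gP (k, x) Sx).2.
- move=> k x Sx; have [[i /= Di ->] _] := gP (k, x) Sx.
  by rewrite distrC; have [_ _] := DP k; exact.
Qed.

End baire_one.

(** * Interpolation near a closed set *)

Section interpolation.
Variables (R : realType) (V Y : normedModType R).
Variables (S : set V) (fn : nat -> V -> Y) (delta : nat -> R).
Hypothesis fn_continuous : forall n, continuous (fn n).
Hypothesis delta_gt0 : forall k, 0 < delta k.
Hypothesis delta_decr : forall k, delta k.+1 < delta k.
Hypothesis delta_cvg0 : forall e, 0 < e -> exists k, delta k < e.

(** Decreases from 1 to 0 as the distance to S goes from delta (k+1) to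
    delta k. *)
Definition weight (k : nat) (x : V) : R :=
  Num.min 1 (Num.max 0 ((delta k - tdist S x) / (delta k - delta k.+1))).

Definition partial_interpolation (n : nat) (x : V) : Y :=
  fn 0 x + \sum_(0 <= k < n) weight k x *: (fn k.+1 x - fn k x).

(** The partial sums are eventually constant off S and equal fn n on S; taking
    their limit handles both cases at once. *)
Definition interpolation (x : V) : Y :=
  lim (partial_interpolation n x @[n --> \oo]).

Lemma delta_anti k m : (k <= m)%N -> delta m <= delta k.
Proof.
move=> /subnK <-; elim: (m - k)%N => [//|j IH].
by rewrite addSn (le_trans (ltW (delta_decr _))).
Qed.

Lemma weight1 k x : tdist S x <= delta k.+1 -> weight k x = 1.
Proof.
move=> dx; apply/min_l; rewrite le_max; apply/orP; right.
by rewrite ler_pdivlMr ?subr_gt0// mul1r lerD2l lerN2.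
Qed.

Lemma weight0 k x : delta k <= tdist S x -> weight k x = 0.
Proof.
move=> dx; rewrite /weight max_l ?min_r//.
by rewrite pmulr_lle0 ?invr_gt0 ?subr_gt0// subr_le0.
Qed.

Lemma weight_itv k x : 0 <= weight k x <= 1.
Proof. by rewrite /weight le_min ler01 le_max lexx ge_min lexx. Qed.

Lemma weight_continuous k : continuous (weight k).
Proof.
move=> x; apply: (@continuous_min _ _ (fun=> 1)
  (fun x => Num.max 0 ((delta k - tdist S x) / (delta k - delta k.+1)))).
  exact: cvg_cst.
apply: (@continuous_max _ _ (fun=> 0)
  (fun x => (delta k - tdist S x) / (delta k - delta k.+1))).
  exact: cvg_cst.
apply: cvgM; last exact: cvg_cst.
by apply: cvgB; [exact: cvg_cst|exact: tdist_continuous].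
Qed.

Lemma partial_interpolation_continuous n : continuous (partial_interpolation n).
Proof.
elim: n => [|n IH] x.
  suff -> : partial_interpolation 0 = fn 0 by exact: fn_continuous.
  by apply/funext => y; rewrite /partial_interpolation big_geq// addr0.
suff -> : partial_interpolation n.+1 = partial_interpolation n \+
    (fun x => weight n x *: (fn n.+1 x - fn n x)).
  apply: cvgD; first exact: IH.
  apply: cvgZ; first exact: weight_continuous.
  by apply: cvgB; exact: fn_continuous.
by apply/funext => y; rewrite /partial_interpolation big_nat_recr//= addrA.
Qed.

Lemma partial_interpolation_near n x : tdist S x <= delta n ->
  partial_interpolation n x = fn n x.
Proof.
move=> dx; rewrite /partial_interpolation (@telescope_sumr_eq _ 0%N n (fn^~ x))//.
  by rewrite addrC subrK.
move=> k /andP[_ kn]; rewrite weight1 ?scale1r//.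
by rewrite (le_trans dx)// delta_anti.
Qed.

Lemma partial_interpolation_far n m x : delta n <= tdist S x -> (n <= m)%N ->
  partial_interpolation m x = partial_interpolation n x.
Proof.
move=> dx nm; rewrite /partial_interpolation (@big_cat_nat _ _ _ n 0%N m)//=.
rewrite [X in _ + (_ + X)]big1_seq ?addr0// => k /andP[_].
rewrite mem_index_iota => /andP[nk _].
by rewrite weight0 ?scale0r// (le_trans (delta_anti nk)).
Qed.

Lemma interpolation_far n x : delta n <= tdist S x ->
  interpolation x = partial_interpolation n x.
Proof.
move=> dx; apply: lim_near_cst => //.
by exists n => // m /= nm; exact: partial_interpolation_far.
Qed.

Lemma interpolation_shell m x : delta m.+1 <= tdist S x <= delta m ->
  interpolation x = fn m x + weight m x *: (fn m.+1 x - fn m x).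
Proof.
move=> /andP[md dm]; rewrite (interpolation_far md) -{1}(partial_interpolation_near dm).
by rewrite /partial_interpolation big_nat_recr//= addrA.
Qed.

Lemma interpolation_on x l : S x -> fn n x @[n --> \oo] --> l ->
  interpolation x = l.
Proof.
move=> Sx fl; apply: cvg_lim => //.
rewrite (_ : (fun n => _) = fn^~ x)//; apply/funext => n.
by rewrite partial_interpolation_near// tdist_eq0// ltW.
Qed.

Lemma interpolation_continuous_off x : closed S -> ~ S x ->
  {for x, continuous interpolation}.
Proof.
move=> cS nSx; have [n nd] := delta_cvg0 (tdist_gt0 cS nSx).
have near_n : \forall y \near x, delta n < tdist S y.
  exact: (cvgr_gt _ (@tdist_continuous _ _ S x)).
rewrite /prop_for /continuous_at (interpolation_far (ltW nd)).
apply: cvg_trans (@partial_interpolation_continuous n x).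
apply: near_eq_cvg; near=> y.
by rewrite (@interpolation_far n)// ltW//; near: y.
Unshelve. all: end_near. Qed.

(** Along p the shells visited have indices tending to infinity, and in the shell
    m the interpolation is a convex combination of fn m and fn (m+1). *)
Lemma interpolation_cvg (T : Type) (Phi : set_system T) (p : T -> V) (s : V)
    (l : Y) : Filter Phi ->
  (\forall t \near Phi, 0 < tdist S (p t)) ->
  tdist S (p t) @[t --> Phi] --> (0 : R) ->
  fn n s @[n --> \oo] --> l ->
  (forall e, 0 < e -> exists N, \forall t \near Phi, forall n, (N <= n)%N ->
    tdist S (p t) < delta n ->
    `|fn n (p t) - fn n s| < e /\ `|fn n.+1 (p t) - fn n.+1 s| < e) ->
  interpolation (p t) @[t --> Phi] --> l.
Proof.
move=> FPhi d_gt0 d0 fl fp; apply/cvgrPdist_lt => e e0.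
have e2 : 0 < e / 2 by rewrite divr_gt0.
have [N near_p] := fp _ e2.
have [M _ near_l] := (cvgrPdist_lt _ _).1 fl _ e2.
have d_small : \forall t \near Phi, tdist S (p t) < delta (maxn N M).
  exact: (cvgr_lt _ d0).
near=> t.
have [dt0 dt1] : 0 < tdist S (p t) /\ tdist S (p t) < delta (maxn N M).
  by split; near: t.
have [k dk kmin] : exists2 k, delta k <= tdist S (p t) &
    forall j, delta j <= tdist S (p t) -> (k <= j)%N.
  have ex : exists k, delta k <= tdist S (p t).
    by have [k /ltW] := delta_cvg0 dt0; exists k.
  by have [k dk kmin] := ex_minnP ex; exists k.
(* k is the outer index of the shell that contains p t: it is not 0 since
   p t is closer to S than delta (maxn N M). *)
have ltk : (maxn N M < k)%N.
  rewrite ltnNge; apply/negP => /delta_anti km.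
  by have := le_lt_trans (le_trans km dk) dt1; rewrite ltxx.
case: k dk kmin ltk => // m dk kmin; rewrite ltnS geq_max => /andP[Nm Mm].
have dm : tdist S (p t) < delta m.
  by rewrite ltNge; apply/negP => /kmin; rewrite ltnn.
rewrite (@interpolation_shell m); last by rewrite dk ltW.
have [fm fm1] : `|fn m (p t) - fn m s| < e / 2 /\
    `|fn m.+1 (p t) - fn m.+1 s| < e / 2.
  have near_t : forall n, (N <= n)%N -> tdist S (p t) < delta n ->
      `|fn n (p t) - fn n s| < e / 2 /\
      `|fn n.+1 (p t) - fn n.+1 s| < e / 2 by near: t.
  exact: near_t.
have lm : `|l - fn m (p t)| < e.
  rewrite (splitr e) -(subrKA (fn m s)) (le_lt_trans (ler_normD _ _))// ltrD//.
    exact: near_l.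
  by rewrite distrC.
have lm1 : `|l - fn m.+1 (p t)| < e.
  rewrite (splitr e) -(subrKA (fn m.+1 s)) (le_lt_trans (ler_normD _ _))// ltrD//.
    by apply: near_l; rewrite /= leqW.
  by rewrite distrC.
have /andP[w0 w1] := weight_itv m (p t); set w := weight m (p t) in w0 w1 *.
have -> : l - (fn m (p t) + w *: (fn m.+1 (p t) - fn m (p t))) =
    (1 - w) *: (l - fn m (p t)) + w *: (l - fn m.+1 (p t)).
  have -> : l - fn m.+1 (p t) =
      (l - fn m (p t)) - (fn m.+1 (p t) - fn m (p t)).
    by rewrite opprB addrA subrK.
  by rewrite scalerBl scale1r (scalerBr w (l - _)) subrKA opprD addrA.
rewrite (le_lt_trans (ler_normD _ _))// !normrZ ger0_norm ?subr_ge0// ger0_norm//.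
have [->|wn1] := eqVneq w 1; first by rewrite subrr mul0r add0r mul1r.
have : (1 - w) * `|l - fn m (p t)| < (1 - w) * e.
  by rewrite ltr_pM2l// subr_gt0 lt_neqAle wn1.
have : w * `|l - fn m.+1 (p t)| <= w * e by rewrite ler_wpM2l// ltW.
lra.
Unshelve. all: end_near. Qed.

End interpolation.

(** * Compactness and segments avoiding an open set *)

Section geometry.
Variable R : realType.

Lemma compact_positive_bound (T : topologicalType) (K : set T) (g : T -> R) :
  compact K -> continuous g -> (forall p, K p -> 0 < g p) ->
  exists2 e, 0 < e & forall p, K p -> e <= g p.
Proof.
move=> cK cg gK.
have cgK : closed (g @` K).
  apply: compact_closed; first exact: norm_hausdorff.
  by apply: continuous_compact => //; exact: continuous_subspaceT.
have [|e e0 eK] := @cball_nbhs _ R^o 0 (~` (g @` K)).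
  apply: open_nbhs_nbhs; split; first exact: closed_openC.
  by move=> [p Kp gp]; have := gK p Kp; rewrite gp ltxx.
exists e => // p Kp; rewrite leNgt; apply/negP => ge.
apply: (eK (g p)); last by exists p.
by rewrite /= sub0r normrN gtr0_norm ?gK// ltW.
Qed.

Variables (n : nat) (Y : normedModType R) (S U : set 'rV[R]_n).
Local Notation V := 'rV[R]_n.
Hypothesis oU : open U.
Hypothesis cS : closed S.

Lemma closed_fst (A : set V) : closed A -> closed [set p : V * V | A p.1].
Proof.
by apply: (@closed_preimage (V * V)%type V fst) => p; exact: cvg_fst.
Qed.

Lemma diff_norm_continuous : continuous (fun p : V * V => `|p.2 - p.1|).
Proof.
by move=> p; apply: cvg_norm; apply: cvgB; [exact: cvg_snd|exact: cvg_fst].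
Qed.

Lemma closed_diff_bound (h : V -> Y) (a : R) : continuous h ->
  closed [set p : V * V | a <= `|h p.2 - h p.1|].
Proof.
move=> ch; apply: (@closed_preimage _ _ (fun p : V * V => `|h p.2 - h p.1|)
  [set t | a <= t]); last exact: closed_ge.
move=> p; apply: cvg_norm; apply: cvgB.
  by apply: continuous_comp; [exact: cvg_snd|exact: ch].
by apply: continuous_comp; [exact: cvg_fst|exact: ch].
Qed.

(** The pairs (s, x) with |h x - h s| >= a and s bounded form a compact set, on
    which |x - s| has a positive minimum.  Where moreover the segment from s to x
    avoids U, x is off S because a segment between two points of S meets U; so
    the distance from x to S has a positive minimum there as well. *)
Lemma uniform_modulus (h : V -> Y) (r a : R) :
  continuous h -> 0 < a ->
  (forall s x, S s -> S x -> s <> x ->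
     exists2 t, 0 <= t <= 1 & U (s + t *: (x - s))) ->
  exists2 e, 0 < e & forall s x, S s -> `|s| <= r -> `|x - s| <= 1 ->
    (`|x - s| < e \/
     (forall t, 0 <= t <= 1 -> ~ U (s + t *: (x - s))) /\ tdist S x < e) ->
    `|h x - h s| < a.
Proof.
move=> ch a0 SU.
pose K := [set p : V * V | S p.1 /\ `|p.1| <= r] `&`
  [set p | `|p.2 - p.1| <= 1] `&` [set p | a <= `|h p.2 - h p.1|].
have cK : compact K.
  apply: (@subclosed_compact _ _ ([set x : V | `|0 - x| <= r] `*`
      [set x : V | `|0 - x| <= r + 1])).
  - apply: closedI; last exact: closed_diff_bound.
    apply: closedI.
      apply: (closed_fst (A := [set s | S s /\ `|s| <= r])).
      apply: closedI => //.
      exact: (closed_preimage (@norm_continuous _ V) (@closed_le _ r)).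
    exact: (closed_preimage diff_norm_continuous (@closed_le _ 1)).
  - by apply: compact_setX; exact: compact_cball.
  - move=> [s x] [[/= [_ sr] xs] _]; rewrite !sub0r !normrN; split => //.
    by rewrite -(subrK s x) addrC (le_trans (ler_normD _ _))// lerD.
have [e1 e1_gt0 e1K] : exists2 e, 0 < e & forall p, K p -> e <= `|p.2 - p.1|.
  apply: compact_positive_bound => //; first exact: diff_norm_continuous.
  move=> [s x] [_ /= hxs]; rewrite normr_gt0 subr_eq0; apply/eqP => xs.
  by move: hxs; rewrite xs subrr normr0 leNgt a0.
pose L := K `&` \bigcap_(t in [set t : R | 0 <= t <= 1])
  [set p : V * V | ~ U (p.1 + t *: (p.2 - p.1))].
have cL : compact L.
  apply: (subclosed_compact _ cK); last by move=> p [].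
  apply: closedI; first by apply: compact_closed => //; exact: norm_hausdorff.
  apply: closed_bigI => t _.
  apply: (@closed_preimage _ _ (fun p : V * V => p.1 + t *: (p.2 - p.1))
    (~` U)); last exact: open_closedC.
  move=> p; apply: cvgD; first exact: cvg_fst.
  apply: cvgZ; first exact: cvg_cst.
  by apply: cvgB; [exact: cvg_snd|exact: cvg_fst].
have [e2 e2_gt0 e2L] : exists2 e, 0 < e & forall p, L p -> e <= tdist S p.2.
  apply: compact_positive_bound => //.
    move=> p; apply: (@continuous_comp _ _ _ snd (tdist S)).
      exact: cvg_snd.
    exact: tdist_continuous.
  move=> [s x] [Kp avoid]; apply: tdist_gt0 => //= Sx.
  have [[[/= Ss _] _] hxs] := Kp.
  have [|t t01] := SU s x Ss Sx; last exact: avoid.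
  by move=> sx; move: hxs; rewrite /= sx subrr normr0 leNgt a0.
exists (Num.min e1 e2); first by rewrite lt_min e1_gt0.
move=> s x Ss sr xs1 close; rewrite ltNge; apply/negP => hxs.
have Kp : K (s, x) by [].
case: close => [|[avoid]]; rewrite lt_min => /andP[].
  by rewrite ltNge (e1K _ Kp).
move=> _; rewrite ltNge => /negP; apply; apply: (e2L (s, x)).
by split => // t; exact: avoid.
Qed.

End geometry.

(** * Extension from the boundary, in coordinates *)

Section line_extension.
Variables (R : realType) (n : nat) (Y : normedModType R).
Local Notation V := 'rV[R]_n.
Variable U : set V.
Hypothesis oU : open U.
Hypothesis scU : strictly_convex U.
Let S := boundary U.

Lemma boundary_openE (X : topologicalType) (A : set X) : open A ->
  boundary A = closure A `\` A.
Proof. by move=> oA; rewrite /boundary ((interior_id A).1 oA). Qed.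

Lemma closed_boundary (X : topologicalType) (A : set X) : closed (boundary A).
Proof.
rewrite /boundary setDE; apply: closedI; first exact: closed_closure.
by apply: open_closedC; exact: open_interior.
Qed.

(** U contains a ball around s + t1 v and the open segments from s to its points,
    hence a ball around s + t v with radius proportional to t. *)
Lemma cone_bound s v t1 : closure U s -> 0 < t1 -> U (s + t1 *: v) ->
  exists2 c, 0 < c & forall t, 0 < t < t1 -> c * t <= tdist S (s + t *: v).
Proof.
move=> Us t1_gt0 Uv.
have [r r_gt0 rU] := cball_nbhs (open_nbhs_nbhs (conj oU Uv)).
exists (Num.min r 1 / t1); first by rewrite divr_gt0// lt_min r_gt0 ltr01.
move=> t /andP[t_gt0 tt1]; apply: le_tdist.
  rewrite mulrAC ler_pdivrMr// mul1r.
  rewrite (le_trans _ (ltW tt1))// ger_pMl// ge_min lexx orbT //.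
move=> a; rewrite /S boundary_openE// => -[Ua nUa].
rewrite leNgt; apply/negP => at_close.
pose l := t / t1.
have l_gt0 : 0 < l by rewrite divr_gt0.
have l_lt1 : l < 1 by rewrite ltr_pdivrMr// mul1r.
(* a lies on the segment from s to w, at parameter l, and w is in the ball
   around s + t1 v. *)
pose w := s + l^-1 *: (a - s).
have Uw : U w.
  apply: rU => /=.
  have -> : s + t1 *: v - w = l^-1 *: (s + t *: v - a).
    rewrite /w opprD addrACA subrr add0r -scalerN opprB.
    have -> : s + t *: v - a = t *: v + (s - a) by rewrite addrCA addrA.
    by rewrite [RHS]scalerDr scalerA /l invf_div divfK ?gt_eqF.
  rewrite normrZ gtr0_norm ?invr_gt0// mulrC ler_pdivrMr// /l mulrA.
  rewrite (le_trans (ltW at_close))// -mulrA (mulrC t1^-1) mulrA.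
  rewrite ler_pM2r ?invr_gt0// ler_pM2r// ge_min lexx //.
have aE : a = (1 - l) *: s + l *: w.
  rewrite /w scalerDr scalerA divff ?gt_eqF// scale1r addrA -scalerDl subrK.
  by rewrite scale1r addrC subrK.
have [sw|sw] := eqVneq s w.
  by apply: nUa; rewrite aE -sw -scalerDl subrK scale1r sw.
apply: nUa; rewrite aE; apply: (scU Us (subset_closure Uw)); first exact/eqP.
by exists l => //=; rewrite l_gt0.
Qed.

Lemma boundary_segment_meets s x : S s -> S x -> s <> x ->
  exists2 t, 0 <= t <= 1 & U (s + t *: (x - s)).
Proof.
rewrite /S !boundary_openE// => -[Us _] [Ux _] sx; exists 2^-1.
  by rewrite invr_ge0 ler0n invf_le1// ler1n.
apply: (scU Us Ux sx); exists 2^-1 => /=.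
  by rewrite invr_gt0 ltr0n invf_lt1// ltr1n.
by rewrite scalerBl scalerBr scale1r addrAC addrA.
Qed.

(** The threshold delta k is at most e k / (k+1), where e k is a modulus valid for
    fn k and fn (k+1) with error 1/(k+1) over the points of S of norm at most k.
    The factor 1/(k+1) absorbs the slope c of [cone_bound], which depends on the
    ray: it suffices that |v| / c <= k+1. *)
Lemma extend_from_boundary (f : V -> Y) (fn : nat -> V -> Y) :
  (forall k, continuous (fn k)) ->
  (forall s, S s -> fn k s @[k --> \oo] --> f s) ->
  exists F : V -> Y, linearly_continuous F /\ forall s, S s -> F s = f s.
Proof.
move=> fc fS.
have cS : closed S by exact: closed_boundary.
have /choice[e eP] : forall k, exists e : R, 0 < e /\
    forall s x, S s -> `|s| <= k%:R -> `|x - s| <= 1 ->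
    (`|x - s| < e \/
     (forall t, 0 <= t <= 1 -> ~ U (s + t *: (x - s))) /\ tdist S x < e) ->
    `|fn k x - fn k s| < k.+1%:R^-1 /\ `|fn k.+1 x - fn k.+1 s| < k.+1%:R^-1.
  move=> k; have k0 : 0 < (k.+1%:R^-1 : R) by rewrite invr_gt0.
  have [e1 e1_gt0 e1P] :=
    uniform_modulus oU cS k%:R (fc k) k0 boundary_segment_meets.
  have [e2 e2_gt0 e2P] :=
    uniform_modulus oU cS k%:R (fc k.+1) k0 boundary_segment_meets.
  exists (Num.min e1 e2); split; first by rewrite lt_min e1_gt0.
  move=> s x Ss sk xs close; split; [apply: e1P => //|apply: e2P => //].
    by case: close => [|[? ]]; rewrite lt_min => /andP[? ?]; [left|right].
  by case: close => [|[? ]]; rewrite lt_min => /andP[? ?]; [left|right].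
pose b k := Num.min (e k / k.+1%:R) 1.
have b_gt0 k : 0 < b k.
  by rewrite lt_min ltr01 andbT divr_gt0 ?(eP k).1.
pose delta := fix d k := if k is k'.+1 then Num.min (d k' / 2) (b k) else b 0%N.
have delta_gt0 k : 0 < delta k.
  elim: k => [|k IH]; first exact: b_gt0.
  by rewrite /= lt_min b_gt0 andbT divr_gt0.
have delta_half k : delta k.+1 <= delta k / 2 by rewrite /= ge_min lexx.
have delta_decr k : delta k.+1 < delta k.
  by rewrite (le_lt_trans (delta_half k))// ltr_pdivrMr// ltr_pMr// ltr1n.
have delta_b k : delta k <= b k.
  by case: k => [|k] //=; rewrite ge_min lexx orbT.
have delta_geo k : delta k <= 2^-1 ^+ k.
  elim: k => [|k IH]; first by rewrite expr0 /= /b ge_min lexx orbT.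
  by rewrite (le_trans (delta_half k))// exprSr ler_pM2r// invr_gt0.
have delta_cvg0 d : 0 < d -> exists k, delta k < d.
  move=> /geometric_lt[k kd].
  by exists k; rewrite (le_lt_trans (delta_geo k)).
pose F := interpolation S fn delta.
have F_on s : S s -> F s = f s.
  by move=> Ss; apply: interpolation_on (fS s Ss).
have ray s v : S s -> v != 0 -> exists (tau : R) (N : nat), 0 < tau /\
    forall t, 0 < t < tau -> 0 < tdist S (s + t *: v) /\
    forall k, (N <= k)%N -> tdist S (s + t *: v) < delta k ->
      `|fn k (s + t *: v) - fn k s| < k.+1%:R^-1 /\
      `|fn k.+1 (s + t *: v) - fn k.+1 s| < k.+1%:R^-1.
  move=> Ss v_neq0; have v_gt0 : 0 < `|v| by rewrite normr_gt0.
  have norm_tv t : 0 < t -> t < `|v|^-1 -> `|s + t *: v - s| = t * `|v| /\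
      `|s + t *: v - s| <= 1.
    move=> t_gt0 tv; rewrite addrAC subrr add0r normrZ gtr0_norm//; split=> //.
    by rewrite -ler_pdivlMr// div1r ltW.
  have [Us nUs] : closure U s /\ ~ U s by move: Ss; rewrite /S boundary_openE.
  have [[t1 [t1_gt0 Ut1]]|noU] := pselect (exists t1, 0 < t1 /\ U (s + t1 *: v)).
    have [c c_gt0 cP] := cone_bound Us t1_gt0 Ut1.
    exists (Num.min t1 `|v|^-1), (Num.bound (`|s| + `|v| / c)).
    split; first by rewrite lt_min t1_gt0 invr_gt0.
    move=> t; rewrite lt_min => /and3P[t_gt0 tt1 tv].
    have [tvE tv1] := norm_tv t t_gt0 tv.
    have ct : c * t <= tdist S (s + t *: v) by apply: cP; rewrite t_gt0.
    split=> [|k Nk dk]; first by rewrite (lt_le_trans _ ct)// mulr_gt0.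
    have : `|s| + `|v| / c < k%:R.
      by rewrite (lt_le_trans (archi_boundP _)) ?ler_nat// addr_ge0// divr_ge0// ltW.
    have : 0 <= `|v| / c by rewrite divr_ge0// ltW.
    move=> vc sk; have [sk1 vk] : `|s| <= k%:R /\ `|v| / c <= k.+1%:R.
      by rewrite -natr1; have := normr_ge0 s; split; lra.
    apply: (eP k).2 => //; left; rewrite tvE.
    have : c * t < e k / k.+1%:R.
      rewrite (le_lt_trans ct)// (lt_le_trans dk)// (le_trans (delta_b k))//.
      by rewrite ge_min lexx.
    rewrite ltr_pdivlMr//; apply: le_lt_trans.
    move: vk; rewrite ler_pdivrMr// => vk.
    by rewrite (mulrC c) -mulrA ler_pM2l// mulrC.
  have avoid t : 0 < t -> forall u, 0 <= u <= 1 ->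
      ~ U (s + u *: (s + t *: v - s)).
    move=> t_gt0 u /andP[u_ge0 _]; rewrite (addrAC s) subrr add0r scalerA.
    have [->|u_neq0] := eqVneq u 0; first by rewrite mul0r scale0r addr0.
    move=> Uu; apply: noU; exists (u * t); split => //.
    by rewrite mulr_gt0// lt_neqAle eq_sym u_neq0.
  exists `|v|^-1, (Num.bound `|s|); split; first by rewrite invr_gt0.
  move=> t /andP[t_gt0 tv]; have [tvE tv1] := norm_tv t t_gt0 tv.
  split=> [|k Nk dk].
    apply: tdist_gt0 => // Sx.
    have [|u u01] := boundary_segment_meets Ss Sx; last exact: avoid.
    move=> sE; have : 0 < `|s + t *: v - s| by rewrite tvE mulr_gt0.
    by rewrite -sE subrr normr0 ltxx.
  apply: (eP k).2 => //.
    by rewrite (le_trans (ltW (archi_boundP _)))// ler_nat.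
  right; split; first exact: avoid.
  rewrite (lt_le_trans dk)// (le_trans (delta_b k))//.
  rewrite /b ge_min ler_pdivrMr// ler_peMr ?ler1n//.
  by have [/ltW] := eP k.
exists F; split => // x v t0.
have line_continuous : {for t0, continuous (fun t : R => x + t *: v)}.
  by apply: cvgD; [exact: cvg_cst|apply: cvgZ; [exact: cvg_id|exact: cvg_cst]].
have [->|v_neq0] := eqVneq v 0.
  by under eq_fun do rewrite scaler0 addr0; exact: cvg_cst.
have [Ss|nSs] := pselect (S (x + t0 *: v)); last first.
  apply: (@continuous_comp _ _ _ (fun t : R => x + t *: v) F) => //.
  exact: interpolation_continuous_off.
have [tau1 [N1 [tau1_gt0 ray1]]] := ray _ v Ss v_neq0.
have [|tau2 [N2 [tau2_gt0 ray2]]] := ray _ (- v) Ss; first by rewrite oppr_eq0.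
(* Both halves of the line are rays, with directions v and - v. *)
have rays : \forall t \near t0^', 0 < tdist S (x + t *: v) /\
    forall k, (maxn N1 N2 <= k)%N -> tdist S (x + t *: v) < delta k ->
      `|fn k (x + t *: v) - fn k (x + t0 *: v)| < k.+1%:R^-1 /\
      `|fn k.+1 (x + t *: v) - fn k.+1 (x + t0 *: v)| < k.+1%:R^-1.
  near=> t.
  have tt0 : t != t0 by near: t; exact: nbhs_dnbhs_neq.
  have t_close : `|t0 - t| < Num.min tau1 tau2.
    near: t; apply: cvg_within.
    by apply: (@cvgr_dist_lt _ _ _ (nbhs t0)) => //; rewrite lt_min tau1_gt0.
  move: t_close; rewrite lt_min => /andP[t_tau1 t_tau2].
  move: tt0; rewrite neq_lt => /orP[tt0|tt0].
    have -> : x + t *: v = x + t0 *: v + (t0 - t) *: (- v).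
      by rewrite scalerN -scaleNr opprB -addrA -scalerDl (addrC t0) subrK.
    have [|d_gt0 H] := ray2 (t0 - t).
      by rewrite subr_gt0 tt0 (le_lt_trans (ler_norm _)).
    by split=> // k; rewrite geq_max => /andP[_]; exact: H.
  have -> : x + t *: v = x + t0 *: v + (t - t0) *: v.
    by rewrite -addrA -scalerDl (addrC t0) subrK.
  have [|d_gt0 H] := ray1 (t - t0).
    by rewrite subr_gt0 tt0 (le_lt_trans (ler_norm _))// distrC.
  by split=> // k; rewrite geq_max => /andP[+ _]; exact: H.
apply/continuous_withinNx.
rewrite [X in _ --> X](F_on _ Ss).
apply: (interpolation_cvg delta_gt0 delta_decr delta_cvg0 _ _ _ (fS _ Ss)).
- by apply: filterS rays => t [].
- apply: cvg_within_filter.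
  have : {for t0, continuous (tdist S \o (fun t : R => x + t *: v))}.
    by apply: continuous_comp => //; exact: tdist_continuous.
  by rewrite /prop_for /continuous_at /= (tdist_eq0 Ss).
- move=> d d0; have [k kd] : exists k, k.+1%:R^-1 < d.
    have [//|k] := @ltr_add_invr R 0 d _.
    by rewrite add0r; exists k.
  exists (maxn (maxn N1 N2) k); apply: filterS rays => t [_ near_t] j.
  rewrite geq_max => /andP[Nj kj] tj.
  have jd : j.+1%:R^-1 < d.
    by rewrite (le_lt_trans _ kd)// lef_pV2 ?posrE// ler_nat ltnS.
  have [f1 f2] := near_t j Nj tj.
  by split; [exact: lt_trans jd|exact: lt_trans jd].
Unshelve. all: end_near. Qed.

End line_extension.

(** * Finite-dimensional Hausdorff topological vector spaces *)

Section topological_module.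
Variables (R : realType) (X : topologicalLmodType R) (T : topologicalType).

Lemma continuous_tvsD (f g : T -> X) : continuous f -> continuous g ->
  continuous (fun t => f t + g t).
Proof.
move=> cf cg t.
exact: (cvg_comp _ _ (cvg_pair (cf t) (cg t)) (@add_continuous X (f t, g t))).
Qed.

Lemma continuous_tvsZ (a : T -> R) (f : T -> X) : continuous a ->
  continuous f -> continuous (fun t => a t *: f t).
Proof.
move=> ca cf t.
exact: (cvg_comp _ _ (cvg_pair (ca t) (cf t))
  (@scale_continuous R X (a t, f t))).
Qed.

End topological_module.

Section linear_functions.
Variables (R : pzRingType) (E F : lmodType R) (g : E -> F).
Hypothesis g_linear : linear g.

Lemma linear_fun0 : g 0 = 0.
Proof.
by apply: (addrI (g 0)); rewrite -{1}[g 0]scale1r -g_linear scaler0 !addr0.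
Qed.

Lemma linear_funD x y : g (x + y) = g x + g y.
Proof. by rewrite -{1}[x]scale1r g_linear scale1r. Qed.

Lemma linear_funZ a x : g (a *: x) = a *: g x.
Proof. by rewrite -[a *: x]addr0 g_linear linear_fun0 addr0. Qed.

End linear_functions.

Section coordinates.
Variables (R : realType) (X : topologicalLmodType R) (n : nat).
Variables (phi : X -> 'rV[R]_n) (psi : 'rV[R]_n -> X).
Hypothesis phi_linear : linear phi.
Hypothesis phiK : cancel phi psi.
Hypothesis psiK : cancel psi phi.

Lemma coord_inv_linear : linear psi.
Proof. by move=> a u v; apply: (can_inj phiK); rewrite phi_linear !psiK. Qed.

Lemma coord_inv_continuous : continuous psi.
Proof.
have psiE u : psi u = \sum_(j < n) u ord0 j *: psi (delta_mx ord0 j).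
  rewrite {1}[u]row_sum_delta.
  have psi_linear := coord_inv_linear.
  rewrite (big_morph psi (linear_funD psi_linear) (linear_fun0 psi_linear)).
  by apply: eq_bigr => j _; rewrite linear_funZ.
suff sum_continuous (s : seq 'I_n) : continuous
    (fun u : 'rV[R]_n => \sum_(j <- s) u ord0 j *: psi (delta_mx ord0 j)).
  by rewrite (funext psiE).
elim: s => [|j s IH].
  by under eq_fun do rewrite big_nil; exact: cst_continuous.
under eq_fun do rewrite big_cons.
apply: continuous_tvsD => //; apply: continuous_tvsZ; last exact: cst_continuous.
exact: coord_continuous.
Qed.

(** The image of the unit sphere is compact, hence closed, and misses 0.  By
    continuity of the scaling, some neighbourhood W of 0 satisfies t W off that
    image for all small t, which forces the coordinates to be bounded on W. *)
Lemma coord_continuous_of_hausdorff : hausdorff_space X -> continuous phi.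
Proof.
move=> hX.
pose sphere := [set u : 'rV[R]_n | `|u| = 1].
have cK : closed (psi @` sphere).
  apply: compact_closed => //; apply: continuous_compact.
    exact/continuous_subspaceT/coord_inv_continuous.
  apply: (subclosed_compact _ (@compact_cball R n 0 1)).
    apply: (@closed_preimage _ _ (fun u : 'rV[R]_n => `|u|) [set 1]).
      exact: norm_continuous.
    exact: closed_eq.
  by move=> u /= u1; rewrite sub0r normrN u1.
have phi0 := linear_fun0 phi_linear.
have nbhs_sphere : nbhs (0 : X) (~` (psi @` sphere)).
  apply: open_nbhs_nbhs; split; first exact: closed_openC.
  move=> [u u1 u0]; move: u1; rewrite /sphere /= -(psiK u) u0 phi0 normr0.
  by move/esym/eqP; rewrite oner_eq0.
have [e e_gt0 [W W0 We]] : exists2 e : R, 0 < e & exists2 W, nbhs (0 : X) W &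
    forall t z, `|t| < e -> W z -> (~` (psi @` sphere)) (t *: z).
  have := @scale_continuous R X (0 : R^o, 0); rewrite /= /continuous_at /= scale0r.
  move=> /(_ _ nbhs_sphere)[[A W] /= [/nbhs_ballP[e /= e0 eA] W0] AW].
  exists e => //; exists W => // t z te Wz; apply: (AW (t, z)); split => //=.
  by apply: eA; rewrite -ball_normE /= sub0r normrN.
have bound z : W z -> `|phi z| <= e^-1.
  move=> Wz; rewrite leNgt; apply/negP => ez.
  have z_gt0 : 0 < `|phi z| by rewrite (lt_trans _ ez)// invr_gt0.
  apply: (We `|phi z|^-1 z _ Wz).
    by rewrite gtr0_norm ?invr_gt0// -(invrK e) ltf_pV2 ?posrE ?invr_gt0.
  exists (phi (`|phi z|^-1 *: z)); last exact: phiK.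
  by rewrite /sphere /= linear_funZ// normrZ gtr0_norm ?invr_gt0// mulVf// gt_eqF.
move=> x; apply/cvgrPdist_le => d d_gt0.
have c_gt0 : 0 < e * d by rewrite mulr_gt0.
have near_W : \forall y \near x, W ((e * d)^-1 *: (y - x)).
  have : continuous (fun y : X => (e * d)^-1 *: (y - x)).
    apply: continuous_tvsZ; first exact: cst_continuous.
    apply: continuous_tvsD; last exact: cst_continuous.
    by move=> y; exact: cvg_id.
  by move=> /(_ x); rewrite /continuous_at subrr scaler0 => /(_ _ W0).
apply: filterS near_W => y /bound; rewrite linear_funZ// normrZ gtr0_norm ?invr_gt0//.
rewrite ler_pdivrMl// mulrAC divff ?gt_eqF// mul1r.
by rewrite linear_funD// -scaleN1r linear_funZ// scaleN1r distrC.
Qed.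

End coordinates.

Lemma Fsigma_set_type (X : topologicalType) (S : set X) (B : set (set_type S)) :
  Fsigma B -> exists2 C : nat -> set X, forall i, closed (C i) &
    forall z : set_type S, B z <-> (\bigcup_i C i) (set_val z).
Proof.
move=> [G cG ->].
have /choice[C CP] : forall i, exists C : set X, closed C /\ G i = set_val @^-1` C.
  move=> i; have [/= O oO eO] := closed_openC (cG i).
  exists (~` O); split; first exact: open_closedC.
  by rewrite -[G i]setCK -eO.
exists C => [i|z]; first exact: (CP i).1.
by split=> -[i _ Gz]; exists i => //; move: Gz; rewrite (CP i).2.
Qed.

(** * Transfer to coordinates *)

Section transfer.
Variables (R : realType) (X : topologicalLmodType R) (n : nat).
Variables (phi : X -> 'rV[R]_n) (psi : 'rV[R]_n -> X).
Hypothesis phiK : cancel phi psi.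
Hypothesis psiK : cancel psi phi.
Hypothesis psi_linear : linear psi.
Hypothesis phi_continuous : continuous phi.
Hypothesis psi_continuous : continuous psi.
Variable U : set X.
Hypothesis oU : open U.

Lemma open_preimage_coord : open (psi @^-1` U).
Proof. by apply: open_comp => // u _; exact: psi_continuous. Qed.

Lemma boundary_preimage_coord :
  boundary (psi @^-1` U) = psi @^-1` boundary U.
Proof.
rewrite !boundary_openE//; last exact: open_preimage_coord.
apply/seteqP; split=> u [Uu nUu]; split => //.
  exact: closure_preimage_sub Uu.
rewrite -(psiK u); apply: (closure_preimage_sub phi_continuous).
by rewrite /preimage /=; under eq_set do rewrite phiK.
Qed.

Lemma strictly_convex_preimage_coord :
  strictly_convex U -> strictly_convex (psi @^-1` U).
Proof.
move=> scU u v Uu Uv uv w [t t01 <-] /=.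
rewrite (linear_funD psi_linear) !(linear_funZ psi_linear).
apply: (scU (psi u) (psi v)); last by exists t.
- exact: closure_preimage_sub Uu.
- exact: closure_preimage_sub Uv.
- by move/(can_inj psiK).
Qed.

End transfer.

(* A set coerces to its subtype [set_type], which the library equips with the
   topology induced by the inclusion. *)
Theorem corollary1p8 (R : realType) (X : topologicalLmodType R)
    (hX : hausdorff_space X) (finX : finite_dimensional X)
    (Y : completeNormedModType R) (U : set X)
    (oU : open U) (scU : strictly_convex U)
    (f : set_type (boundary U) -> Y) (mf : Fsigma_measurable R f) :
  exists fbar : X -> Y,
    linearly_continuous fbar /\
    (forall z : set_type (boundary U), fbar (set_val z) = f z).
Proof.
have [n [[phi phi_linear [psi phiK psiK]]]] := finX.
have psi_linear := coord_inv_linear phi_linear phiK psiK.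
have psi_continuous := coord_inv_continuous phi_linear phiK psiK.
have phi_continuous := coord_continuous_of_hausdorff phi_linear phiK psiK hX.
pose S := boundary (psi @^-1` U).
have SE : S = psi @^-1` boundary U by exact: boundary_preimage_coord.
(* Outside the boundary the value 0 is arbitrary. *)
pose g u : Y := if pselect (boundary U (psi u)) is left bu
  then f (SigSub (mem_set bu)) else 0.
have gE z : g (phi (set_val z)) = f z.
  rewrite /g phiK; case: pselect => [bz|]; first by congr f; apply: val_inj.
  by case; apply: set_mem; exact: (valP z).
have mg A : functionally_open R A -> Fsigma (S `&` g @^-1` A).
  move=> /mf/Fsigma_set_type[C cC fC].
  have cS : closed S by exact: closed_boundary.
  exists (fun i => S `&` psi @^-1` C i).
    by move=> i; apply: closedI => //; exact: closed_preimage.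
  apply/seteqP; split=> [u [Su Au]|u [i _ [Su Cu]]].
    have bu : boundary U (psi u) by rewrite SE in Su.
    have [+ _] := fC (SigSub (mem_set bu)).
    rewrite /preimage /= -gE /= psiK => /(_ Au)[i _ Ci].
    by exists i.
  split => //.
  have bu : boundary U (psi u) by rewrite SE in Su.
  have [_] := fC (SigSub (mem_set bu)).
  by rewrite /preimage /= -gE /= psiK; apply; exists i.
have cS : closed S by exact: closed_boundary.
have [gn [gn_continuous gn_cvg]] := baire_one_of_covers
  (fun e => @small_oscillation_cover R n Y S g mg e cS).
have [F [F_continuous FE]] := extend_from_boundary
  (open_preimage_coord psi_continuous oU)
  (strictly_convex_preimage_coord psiK psi_linear psi_continuous scU)
  gn_continuous gn_cvg.
exists (F \o phi); split=> [x v|z] /=.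
  rewrite (_ : (fun t => _) = (fun t => F (phi x + t *: phi v))).
    exact: F_continuous.
  by apply/funext => t; rewrite (linear_funD phi_linear) linear_funZ.
rewrite FE ?gE// -/S SE /preimage /= phiK.
by apply: set_mem; exact: (valP z).
Qed.
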